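(* Let $\gamma:[a,b]\to\mathbb K\setminus\{0\}$ be a tame path with $\gamma^{-1}(\mathbb R)=\{a\le t_1<\dots<t_p\le b\}$ and with all the parameters in $\gamma^{-1}(\mathbb R)\cap(a,b)$ tame. Assume that a lift $\Gamma$ of $\gamma|_{[a,t_1]}$ in $\mathcal E_{\mathbb K}^+$ exists and equals $\Gamma(t)=(\gamma(t),\operatorname{Arg}_{k_0}(\gamma(t)))\in\mathcal E_{\mathbb K}^+$, $t\in[a,t_1]$, for some $k_0\in\mathbb Z$. Then the lift of $\gamma|_{[t_p,b)}$ (obtained by continuing $\Gamma$ along $\gamma$) is given by $$\big(\gamma(t),\operatorname{Arg}_{k_0+(-1)^{k_0}\sigma(\gamma)}(\gamma(t))\big),\qquad t\in[t_p,b).$$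
   Context: $\mathbb K$ denotes either the algebra of quaternions or the algebra of octonions, $\operatorname{Im}(\mathbb K)$ its space of purely imaginary elements, $\mathbb S=\{I\in\mathbb K: I^2=-1\}$ and $\mathbb C_I=\mathbb R+\mathbb RI$. A path is a continuous map from an interval. $\exp(q)=\sum_{k\ge 0}q^k/k!$. The logarithm manifold is $\mathcal E_{\mathbb K}^+=\{(r\exp p,p): r>0,\ p\in\operatorname{Im}(\mathbb K)\}\subset\mathbb K\times\operatorname{Im}(\mathbb K)$; a lift of a path is a continuous map to $\mathcal E_{\mathbb K}^+$ whose first component is the path. A companion of a path $\gamma$ is a path $\mathfrak I^\gamma:[a,b]\to\mathbb S/\{\pm\mathrm{Id}\}$ (antipodal quotient) with $\gamma(t)\in\mathbb C_{\mathfrak I^\gamma(t)}$ for every $t$, where $\mathbb C_{[J]}=\mathbb C_J=\mathbb C_{-J}$; $\gamma$ is tame if it has a unique companion. Write $\gamma=x+Y$ with $x$ real and $Y$ purely imaginary. A parameter $t_s\in\gamma^{-1}(\mathbb R)\cap(a,b)$ is tame if the limits $\lim_{t\to t_s^\pm}Y(t)/|Y(t)|$ both exist and are equal or opposite; it is then called a bounce if they are equal and a flip if they are opposite. Let $a<\xi_1<\dots<\xi_m<b$ be the flips. The signature is $\sigma(\gamma)=\sum_{l=1}^m\operatorname{sign}(\gamma(\xi_l))(-1)^l$, and $\sigma(\gamma)=0$ if there are no flips. For $q=x+Iy\in\mathbb K\setminus\mathbb R$ with $y>0$, $I\in\mathbb S$, put $\mathcal I(q)=I$ and $\arg_{\mathcal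 I}(q)=\cot^{-1}(x/y)\in(0,\pi)$. The branches of the argument are, for $l\in\mathbb Z$, $\operatorname{Arg}_{2l}(q)=\mathcal I(q)(\arg_{\mathcal I}(q)+2l\pi)$ and $\operatorname{Arg}_{2l+1}(q)=-\mathcal I(q)\big(2\pi-\arg_{\mathcal I}(q)+2l\pi\big)$. At parameters $t$ with $\gamma(t)\in\mathbb R$, $\operatorname{Arg}_k(\gamma(t))$ is understood as the continuous extension (one-sided limit) from within the interval under consideration: at $t_1$ from $[a,t_1)$ (from the right if $t_1=a$), at $a$ from the right, and at $t_p$ from $(t_p,b)$. *)

(* Defs.v *)
From HB Require Import structures.
From mathcomp Require Import all_boot all_order all_algebra generic_quotient.
From mathcomp Require Import finmap.
From mathcomp Require Import all_classical all_reals all_analysis.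
From mathcomp Require Import ring lra.

Set Implicit Arguments.
Unset Strict Implicit.
Unset Printing Implicit Defensive.

Import Order.TTheory GRing.Theory Num.Theory.
Import numFieldNormedType.Exports.

Local Open Scope classical_set_scope.
Local Open Scope ring_scope.

(* The algebras are obtained from the reals by Cayley-Dickson doubling:
   [cd R 1] is C, [cd R 2] is H and [cd R 3] is O.  The norm of the library's
   product spaces is the max norm: it gives the usual topology, but the
   Euclidean norm |q| is [modulus q] below. *)
Fixpoint cd (R : realType) (n : nat) : normedModType R :=
  if n is m.+1 then (cd R m * cd R m)%type : normedModType R
  else R^o : normedModType R.

Variant hypercomplex := Quaternions | Octonions.

Definition doublings (A : hypercomplex) : nat :=
  if A is Quaternions then 2 else 3.

Notation hyper R A := (cd R (doublings A)).

Section Algebra.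
Variable R : realType.

Fixpoint cd_one n : cd R n :=
  match n return cd R n with
  | 0 => (1 : R)
  | m.+1 => (cd_one m, 0)
  end.

Fixpoint cd_conj n : cd R n -> cd R n :=
  match n return cd R n -> cd R n with
  | 0 => id
  | m.+1 => fun q => (cd_conj q.1, - q.2)
  end.

Fixpoint cd_mul n : cd R n -> cd R n -> cd R n :=
  match n return cd R n -> cd R n -> cd R n with
  | 0 => fun x y => (x : R) * (y : R)
  | m.+1 => fun p q =>
      (cd_mul p.1 q.1 - cd_mul (cd_conj q.2) p.2,
       cd_mul q.2 p.1 + cd_mul p.2 (cd_conj q.1))
  end.

Fixpoint re n : cd R n -> R :=
  match n return cd R n -> R with
  | 0 => id
  | m.+1 => fun q => re q.1
  end.

Section Level.
Variable n : nat.
Implicit Types q p I : cd R n.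

Definition im q : cd R n := q - re q *: cd_one n.

Definition modulus q : R := Num.sqrt (re (cd_mul q (cd_conj q))).

Definition reals : set (cd R n) := [set q | exists x : R, q = x *: cd_one n].

Definition imaginary : set (cd R n) := [set q | re q = 0].

Definition sphere : set (cd R n) := [set I | cd_mul I I = - cd_one n].

Definition slice I : set (cd R n) :=
  [set q | exists x y : R, q = x *: cd_one n + y *: I].

Definition power q (j : nat) : cd R n := iter j (cd_mul q) (cd_one n).

Definition exponential q : cd R n :=
  limn (series (fun j : nat => (j`!%:R : R)^-1 *: power q j)).

Definition log_manifold : set (cd R n * cd R n) :=
  [set z | exists (r : R) p, [/\ 0 < r, imaginary p
                               & z = (r *: exponential p, p)]].

(* The unit [I] of [q = x + y I], [y > 0] (see [unit_imE]); for real [q] the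
   value is 0 and carries no meaning. *)
Definition unit_im q : cd R n := (modulus (im q))^-1 *: im q.

End Level.

(* The inverse of the cotangent with values in (0, pi); see [acotP]. *)
Definition acot (x : R) : R := pi / 2 - atan x.

Section Branches.
Variable n : nat.
Implicit Types (q : cd R n) (k l : int).

Definition arg q : R := acot (re q / modulus (im q)).

(* [l] is the floor of [k / 2]; see [Arg_even] and [Arg_odd]. *)
Definition Arg k q : cd R n :=
  let l := ((k %/ 2)%Z)%:~R : R in
  if (2 %| k)%Z then (arg q + 2 * l * pi) *: unit_im q
  else - ((2 * pi - arg q + 2 * l * pi) *: unit_im q).

End Branches.

Section Antipodal.
Variable n : nat.

Definition antipodal : rel (@sphere n) :=
  [rel I J | (val I == val J) || (val I == - val J)].

Lemma antipodal_refl : reflexive antipodal.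
Proof. by move=> I; apply/orP; left; apply/eqP. Qed.

Lemma antipodal_sym : symmetric antipodal.
Proof.
move=> I J; apply/idP/idP => /orP[] /eqP e; apply/orP;
  [left | right | left | right]; by rewrite e ?opprK; apply/eqP.
Qed.

Lemma antipodal_trans : transitive antipodal.
Proof.
move=> J I K /orP[] /eqP e1 /orP[] /eqP e2; apply/orP;
  [left | right | right | left]; by rewrite e1 e2 ?opprK; apply/eqP.
Qed.

Canonical antipodal_equiv :=
  EquivRel antipodal antipodal_refl antipodal_sym antipodal_trans.

Definition antipodal_quotient :=
  quotient_topology {eq_quot antipodal}%qT.

(* See [class_slice_pi] for the independence of the representative. *)
Definition class_slice (c : antipodal_quotient) : set (cd R n) :=
  slice (val (repr (c : {eq_quot antipodal}%qT))).

End Antipodal.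

Section Paths.
Variable n : nat.
Implicit Types (gamma : R -> cd R n) (a b s : R).

(* Paths on an interval are total functions of which only the values on the
   interval matter. *)
Definition companion gamma a b (J : R -> antipodal_quotient n) : Prop :=
  {within `[a, b], continuous J} /\
  (forall s, s \in `[a, b] -> class_slice (J s) (gamma s)).

Definition tame gamma a b : Prop :=
  exists2 J, companion gamma a b J &
    forall J', companion gamma a b J' -> {in `[a, b], J' =1 J}.

Definition is_lift gamma (D : set R) (Gamma : R -> cd R n * cd R n) : Prop :=
  {within D, continuous Gamma} /\
  (forall s, D s -> log_manifold (Gamma s) /\ (Gamma s).1 = gamma s).

Definition bounce gamma a b s : Prop :=
  [/\ a < s < b, reals (gamma s) &
    exists2 I : cd R n, unit_im (gamma u) @[u --> s^'-] --> I &
               unit_im (gamma u) @[u --> s^'+] --> I].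

Definition flip gamma a b s : Prop :=
  [/\ a < s < b, reals (gamma s) &
    exists2 I : cd R n, unit_im (gamma u) @[u --> s^'-] --> I &
               unit_im (gamma u) @[u --> s^'+] --> - I].

Definition tame_parameter gamma a b s : Prop :=
  bounce gamma a b s \/ flip gamma a b s.

(* The increasing list of the flips, if there are finitely many. *)
Definition flips gamma a b : seq R :=
  sort <=%O (enum_fset (fset_set [set s | flip gamma a b s])).

(* Indices start at 0, hence [l.+1]. *)
Definition signature gamma a b : int :=
  let xi := flips gamma a b in
  \sum_(l < size xi) sgz (re (gamma (xi`_l))) * (-1) ^+ l.+1.

(* [v] is the value at [s] of the [k]-th branch of the argument along [gamma]:
   at a real point it is the limit (required to exist) along [F], meant to be a
   one-sided neighborhood filter of [s]. *)
Definition Arg_along gamma (F : set_system R) (k : int) s (v : cd R n) : Prop :=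
  (reals (gamma s) -> Arg k (gamma u) @[u --> F] --> v) /\
  (~ reals (gamma s) -> v = Arg k (gamma s)).

End Paths.
End Algebra.

Section SanityChecks.
Variable R : realType.

Lemma reD n (p q : cd R n) : re (p + q) = re p + re q.
Proof. by elim: n p q => //= n IH p q; rewrite IH. Qed.

Lemma reZ n (c : R) (q : cd R n) : re (c *: q) = c * re q.
Proof. by elim: n q => //= n IH q; rewrite IH. Qed.

Lemma re1 n : re (cd_one R n) = 1.
Proof. by elim: n => //= n ->. Qed.

Lemma conjD n (p q : cd R n) : cd_conj (p + q) = cd_conj p + cd_conj q.
Proof.
elim: n p q => //= n IH p q; rewrite IH.
by congr (_, _); rewrite opprD.
Qed.

Lemma conjZ n (c : R) (q : cd R n) : cd_conj (c *: q) = c *: cd_conj q.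
Proof.
elim: n q => //= n IH q; rewrite IH.
by congr (_, _); rewrite scalerN.
Qed.

Lemma conj1 n : cd_conj (cd_one R n) = cd_one R n.
Proof. by elim: n => //= n ->; rewrite oppr0. Qed.

Lemma cd_mul_bilinear n (c : R) (p q s : cd R n) :
  cd_mul (c *: p + q) s = c *: cd_mul p s + cd_mul q s /\
  cd_mul s (c *: p + q) = c *: cd_mul s p + cd_mul s q.
Proof.
elim: n p q s => [|n IH] p q s.
  by split; rewrite /= ?mulrDl ?mulrDr [LHS]/= -?scalerAl -?scalerAr.
have linl u v w := (IH u v w).1; have linr u v w := (IH u v w).2.
have scale d (u v : cd R n) : d *: (u + v) = d *: u + d *: v by rewrite scalerDr.
split; apply: injective_projections => /=.
- by rewrite linl linr scalerBr opprD addrACA.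
- by rewrite linr linl scalerDr addrACA.
- by rewrite linr conjD conjZ linl scalerBr opprD addrACA.
- by rewrite linl conjD conjZ linr scalerDr addrACA.
Qed.

Lemma cd_mulDl n (p q s : cd R n) :
  cd_mul (p + q) s = cd_mul p s + cd_mul q s.
Proof. by have := (cd_mul_bilinear 1 p q s).1; rewrite !scale1r. Qed.

Lemma cd_mulDr n (p q s : cd R n) :
  cd_mul s (p + q) = cd_mul s p + cd_mul s q.
Proof. by have := (cd_mul_bilinear 1 p q s).2; rewrite !scale1r. Qed.

Lemma cd_mul0l n (s : cd R n) : cd_mul 0 s = 0.
Proof. by apply: (addrI (cd_mul 0 s)); rewrite -cd_mulDl !addr0. Qed.

Lemma cd_mul0r n (s : cd R n) : cd_mul s 0 = 0.
Proof. by apply: (addrI (cd_mul s 0)); rewrite -cd_mulDr !addr0. Qed.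

Lemma cd_mulZl n (c : R) (p s : cd R n) : cd_mul (c *: p) s = c *: cd_mul p s.
Proof. by have := (cd_mul_bilinear c p 0 s).1; rewrite cd_mul0l !addr0. Qed.

Lemma cd_mulZr n (c : R) (p s : cd R n) : cd_mul s (c *: p) = c *: cd_mul s p.
Proof. by have := (cd_mul_bilinear c p 0 s).2; rewrite cd_mul0r !addr0. Qed.

Lemma cd_mul1r n (q : cd R n) :
  cd_mul (cd_one R n) q = q /\ cd_mul q (cd_one R n) = q.
Proof.
elim: n q => [|n IH] q; first by split; rewrite /= ?mul1r ?mulr1.
have l u := (IH u).1; have r u := (IH u).2.
have cd_conj0 : cd_conj (0 : cd R n) = 0 by rewrite -(scale0r 0) conjZ !scale0r.
split; rewrite /= ?conj1 ?cd_conj0 ?cd_mul0l ?cd_mul0r ?l ?r.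
  by rewrite subr0 addr0 -surjective_pairing.
by rewrite subr0 add0r -surjective_pairing.
Qed.

Lemma conjE n (q : cd R n) : cd_conj q = (2 * re q) *: cd_one R n - q.
Proof.
elim: n q => [|n IH] q /=; first by rewrite [RHS]/= /GRing.scale/=; ring.
rewrite {1}IH; apply: injective_projections => //=.
by rewrite scaler0 add0r.
Qed.

Lemma mul_conj n (q : cd R n) :
  cd_mul q (cd_conj q) = re (cd_mul q (cd_conj q)) *: cd_one R n /\
  cd_mul (cd_conj q) q = re (cd_mul q (cd_conj q)) *: cd_one R n.
Proof.
suff h : cd_mul q (cd_conj q) = re (cd_mul q (cd_conj q)) *: cd_one R n.
  split=> //; rewrite -h; rewrite conjE -scaleN1r.
  by rewrite cd_mulDl cd_mulDr !cd_mulZl !cd_mulZr (cd_mul1r q).1 (cd_mul1r q).2.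
elim: n q => [|n IH] q /=; first by rewrite /GRing.scale/= mulr1.
have comm u : cd_mul (cd_conj u) u = cd_mul u (cd_conj u) :> cd R n.
  rewrite conjE -scaleN1r.
  by rewrite cd_mulDl cd_mulDr !cd_mulZl !cd_mulZr (cd_mul1r u).1 (cd_mul1r u).2.
have conjN (u : cd R n) : cd_conj (- u) = - cd_conj u by rewrite -scaleN1r conjZ scaleN1r.
have mulNl (u v : cd R n) : cd_mul (- u) v = - cd_mul u v.
  by rewrite -scaleN1r cd_mulZl scaleN1r.
have conjK (u : cd R n) : cd_conj (cd_conj u) = u.
  rewrite conjE conjE reD -[- u]scaleN1r !reZ re1 mulr1 scaleN1r.
  rewrite opprD opprK addrA -scalerBl.
  by rewrite (_ : _ - _ = 0) ?scale0r ?add0r//; ring.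
apply: injective_projections => /=.
  rewrite conjN mulNl opprK comm reD scalerDl -IH -IH.
  by [].
by rewrite conjK mulNl addNr scaler0.
Qed.

Lemma sqrE n (q : cd R n) :
  cd_mul q q = (2 * re q) *: q - re (cd_mul q (cd_conj q)) *: cd_one R n.
Proof.
rewrite -(mul_conj q).1 conjE -[- q]scaleN1r cd_mulDr !cd_mulZr (cd_mul1r q).2.
by rewrite [X in _ - (_ + X)]scaleN1r opprD opprK addrA subrr add0r.
Qed.

Lemma cd_one_neq0 n : cd_one R n != 0.
Proof.
apply/eqP => e; have := re1 n; rewrite e -(scale0r 0) reZ mul0r => /esym/eqP.
by rewrite oner_eq0.
Qed.

Lemma sphereE n (I : cd R n) :
  sphere I <-> imaginary I /\ re (cd_mul I (cd_conj I)) = 1.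
Proof.
rewrite /sphere /imaginary /=; split; last first.
  by move=> [r0 N1]; rewrite sqrE r0 N1 mulr0 scale0r sub0r scale1r.
move=> II.
have := sqrE I; rewrite II; set N := re (cd_mul _ _) => e.
have [r0|r0] := eqVneq (re I) 0.
  split=> //; move: e; rewrite r0 mulr0 scale0r sub0r => /oppr_inj.
  rewrite -{1}[cd_one R n]scale1r => /eqP.
  rewrite -subr_eq0 -scalerBl scaler_eq0 (negbTE (cd_one_neq0 n)) orbF.
  by rewrite subr_eq0 => /eqP.
have E : I = ((2 * re I)^-1 * (N - 1)) *: cd_one R n.
  apply: (scalerI (a := 2 * re I)); first by rewrite mulf_neq0 ?pnatr_eq0.
  rewrite scalerA mulrA divff ?mul1r ?mulf_neq0 ?pnatr_eq0//.
  by rewrite scalerBl scale1r e addrCA subrr addr0.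
move: II; rewrite E cd_mulZl cd_mulZr (cd_mul1r _).1 -[- cd_one R n]scaleN1r scalerA.
move=> /(congr1 (@re R n)); rewrite !reZ re1 !mulr1 -expr2 => c2.
by have := sqr_ge0 ((2 * re I)^-1 * (N - 1)); rewrite c2 ler0N1.
Qed.

Lemma unit_imE n (x y : R) (I : cd R n) : 0 < y -> sphere I ->
  let q := x *: cd_one R n + y *: I in
  [/\ re q = x, modulus (im q) = y & unit_im q = I].
Proof.
move=> y0 /sphereE[r0 N1] q.
have rq : re q = x by rewrite reD !reZ re1 r0 mulr0 mulr1 addr0.
have iq : im q = y *: I by rewrite /im rq /q addrAC subrr add0r.
have mq : modulus (im q) = y.
  rewrite /modulus iq conjZ cd_mulZl cd_mulZr !reZ N1 mulr1 -expr2.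
  by rewrite sqrtr_sqr gtr0_norm.
by split=> //; rewrite /unit_im mq iq scalerA mulVf ?scale1r// gt_eqF.
Qed.

Lemma acotP (x : R) : [/\ 0 < acot x, acot x < pi & cos (acot x) / sin (acot x) = x].
Proof.
have := atan_gtNpi2 x; have := atan_ltpi2 x; have := pi_gt0 R => p0 h1 h2.
rewrite /acot; split; [lra | lra |].
have -> : pi / 2 - atan x = - atan x + pi / 2 by ring.
rewrite cosDpihalf sinDpihalf cosN sinN opprK.
exact: atanK.
Qed.

Lemma Arg_even n (q : cd R n) (l : int) :
  Arg (2 * l) q = (arg q + 2 * l%:~R * pi) *: unit_im q.
Proof. by rewrite /Arg dvdz_mulr// mulKz. Qed.

Lemma Arg_odd n (q : cd R n) (l : int) :
  Arg (2 * l + 1) q = - ((2 * pi - arg q + 2 * l%:~R * pi) *: unit_im q).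
Proof.
have d2 : ((2 * l + 1) %/ 2)%Z = l by rewrite mulrC divzMDl// addr0.
have n2 : (2 %| 2 * l + 1)%Z = false.
  by apply/dvdz_mod0P; rewrite mulrC modzMDl.
by rewrite /Arg n2 d2.
Qed.

Lemma class_slice_pi n (I : @sphere R n) :
  class_slice (\pi_(antipodal_quotient R n) I)%qT = slice (val I).
Proof.
rewrite /class_slice; set J := repr _.
have : (J == I %[mod {eq_quot (@antipodal R n)}])%qT by rewrite reprK.
rewrite eqmodE => /orP[]/eqP -> //.
by apply/seteqP; split=> q [x [y ->]]; exists x, (- y);
  rewrite ?scalerN scaleNr ?opprK.
Qed.

(* i j = k = - j i in the quaternions. *)
Example quaternion_ij :
  let i : hyper R Quaternions := ((0, 1), (0, 0)) in
  let j : hyper R Quaternions := ((0, 0), (1, 0)) in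
  let k : hyper R Quaternions := ((0, 0), (0, 1)) in
  cd_mul i j = k /\ cd_mul j i = - k.
Proof.
split; congr ((_, _), (_, _)); rewrite /=; ring.
Qed.
End SanityChecks.

(* Main.v *)
Require Import Defs.
From HB Require Import structures.
From mathcomp Require Import all_boot all_order all_algebra.
From mathcomp Require Import finmap.
From mathcomp Require Import all_classical all_reals all_analysis.
From mathcomp Require Import ring lra zify.

Set Implicit Arguments.
Unset Strict Implicit.
Unset Printing Implicit Defensive.

Import Order.TTheory GRing.Theory Num.Theory.
Import numFieldNormedType.Exports.

Local Open Scope classical_set_scope.
Local Open Scope ring_scope.

(* Over a nonreal q the points of the logarithm manifold are the
   (arg q + 2 m pi) I(q) with m an integer, so a lift follows one branch between
   two consecutive real points.  When q tends to a real point x with I(q) -> I,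
   this branch tends to 2 m pi I if x > 0 and to (2 m + 1) pi I if x < 0.  At a
   bounce I is the same on both sides and continuity keeps m; at a flip I changes
   sign and continuity forces m -> - m if x > 0 and m -> - m - 1 if x < 0, that
   is k -> k - (-1)^k sign x for the index k of Arg_k.  Every flip changes the
   parity of k, whence the alternating sum. *)

(** Nonassociativity never interferes: powers of [c *: I] are computed from I I = -1 and bilinearity
    alone, so all levels of the doubling are treated at once. The delicate points are the real ones,
    where [unit_im] and [arg] carry only conventional values, so branches are compared there through
    one-sided limits. At an interior real point tameness supplies the limits of I(q). At t_1 = a
    only a limit of the given branch is available, and if that limit is 0 then I(q) itself may
    diverge. Uniqueness on a gap therefore rests on the difference of two branches: if they differ,
    it is a fixed nonzero multiple of I(q), which cannot tend to 0. Continuing the lift amounts to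
    two claims: a lift on [a, b) extending the given one exists, and every such lift is the stated
    branch on [t_p, b). Both rest on one fact: at an interior real point the left limit of the old
    branch and the right limit of the new one coincide, and this common value lies over the point in
    the manifold. *)

(** * The squared Euclidean norm is positive definite *)

Section NormSquared.
Variable R : realType.

Lemma normsq_pair n (p q : cd R n) :
  re (cd_mul ((p, q) : cd R n.+1) (cd_conj ((p, q) : cd R n.+1))) =
  re (cd_mul p (cd_conj p)) + re (cd_mul q (cd_conj q)).
Proof.
rewrite /= -[- q]scaleN1r conjZ cd_mulZl scaleN1r opprK reD.
by rewrite (mul_conj q).2 reZ re1 mulr1.
Qed.

Lemma normsq_ge0 n (q : cd R n) : 0 <= re (cd_mul q (cd_conj q)).
Proof.
elim: n q => [|n IH]; first by move=> q; rewrite /= -expr2 sqr_ge0.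
by case=> p q; rewrite (@normsq_pair n p q); apply: addr_ge0; exact: IH.
Qed.

Lemma normsq_eq0 n (q : cd R n) : re (cd_mul q (cd_conj q)) = 0 -> q = 0.
Proof.
elim: n q => [|n IH]; first by move=> q /= /eqP; rewrite mulf_eq0 orbb => /eqP.
case=> p q; rewrite (@normsq_pair n p q) => /eqP.
rewrite paddr_eq0; [|exact: normsq_ge0..] => /andP[/eqP h1 /eqP h2].
by rewrite (IH _ h1) (IH _ h2).
Qed.

End NormSquared.

(** * Real and imaginary parts, units, and powers inside a slice *)

Section Algebra.
Variables (R : realType) (n : nat).
Implicit Types (q p I : cd R n).

Lemma modulus_gt0 q : q != 0 -> 0 < modulus q.
Proof.
move=> q0; rewrite sqrtr_gt0 lt_neqAle normsq_ge0 andbT.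
by apply: contra q0 => /eqP /esym /normsq_eq0 ->.
Qed.

Lemma modulus0 : modulus (0 : cd R n) = 0.
Proof. by rewrite /modulus cd_mul0l -(scale0r 0) reZ mul0r sqrtr0. Qed.

Lemma re_modulus q : re (cd_mul q (cd_conj q)) = modulus q ^+ 2.
Proof. by rewrite sqr_sqrtr ?normsq_ge0. Qed.

Lemma re_im q : re (im q) = 0.
Proof. by rewrite /im -scaleN1r reD reZ reZ re1; ring. Qed.

Lemma reimE q : q = re q *: cd_one R n + im q.
Proof. by rewrite /im addrCA subrr addr0. Qed.

Lemma realsP q : reals q <-> im q = 0.
Proof.
split=> [[x ->]|q0]; last by exists (re q); rewrite {1}[q]reimE q0 addr0.
by rewrite /im reZ re1 mulr1 subrr.
Qed.

Lemma modulus_im_gt0 q : ~ reals q -> 0 < modulus (im q).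
Proof. by move=> /realsP/eqP; exact: modulus_gt0. Qed.

Lemma unit_im_sphere q : ~ reals q -> sphere (unit_im q).
Proof.
move=> /modulus_im_gt0 q0; apply/sphereE; split.
  by rewrite /imaginary /= /unit_im reZ re_im mulr0.
rewrite /unit_im conjZ cd_mulZl cd_mulZr !reZ re_modulus.
by field; rewrite gt_eqF.
Qed.

Lemma im_unit_im q : ~ reals q -> im q = modulus (im q) *: unit_im q.
Proof.
by move=> /modulus_im_gt0 q0; rewrite /unit_im scalerA divff ?scale1r ?gt_eqF.
Qed.

Lemma sphere_neq0 I : sphere I -> I != 0.
Proof.
move=> /sphereE[_ N1]; apply/eqP => I0; move: N1.
by rewrite re_modulus I0 modulus0 expr0n /= => /esym/eqP; rewrite oner_eq0.
Qed.

Lemma sphereN I : sphere I -> sphere (- I).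
Proof.
by rewrite /sphere /= => <-; rewrite -scaleN1r cd_mulZl cd_mulZr scalerA mulrNN mul1r scale1r.
Qed.

(** The real part of p times the conjugate of I is the Euclidean inner product. It recovers a
    coefficient along I by an expression continuous in both arguments, which [turns] exploits. *)
Lemma re_mul_conj_sphere (c : R) I : sphere I -> re (cd_mul (c *: I) (cd_conj I)) = c.
Proof. by move=> /sphereE[_ N1]; rewrite cd_mulZl reZ N1 mulr1. Qed.

Lemma imaginary_polar p : imaginary p -> p != 0 ->
  exists2 I, sphere I & p = modulus p *: I.
Proof.
move=> p0 /modulus_gt0 m0; exists ((modulus p)^-1 *: p); last first.
  by rewrite scalerA divff ?scale1r ?gt_eqF.
apply/sphereE; split; first by rewrite /imaginary /= reZ p0 mulr0.
by rewrite conjZ cd_mulZl cd_mulZr !reZ re_modulus; field; rewrite gt_eqF.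
Qed.

(** Even powers are multiples of 1 and odd powers multiples of I, with a sign that changes every
    second step. Each step multiplies [c *: I] by a multiple of 1 or of I, so associativity is not
    involved. After division by the factorial these are the terms of the cosine and sine series. *)
Lemma power_sphere (c : R) I (j : nat) : sphere I ->
  (j`!%:R : R)^-1 *: power (c *: I) j =
  cos_coeff c j *: cd_one R n + sin_coeff c j *: I.
Proof.
move=> II.
have pw k : power (c *: I) k.*2 = ((-1) ^+ k * c ^+ k.*2) *: cd_one R n /\
            power (c *: I) k.*2.+1 = ((-1) ^+ k * c ^+ k.*2.+1) *: I.
  elim: k => [|k [_ IH]].
    by rewrite /power/= expr0 !mul1r expr1 scale1r (cd_mul1r _).2.
  have e : power (c *: I) k.+1.*2 = ((-1) ^+ k.+1 * c ^+ k.+1.*2) *: cd_one R n.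
    rewrite doubleS {1}/power iterS -/(power _ _) IH cd_mulZl cd_mulZr II scalerA.
    by rewrite scalerN -scaleNr !exprS; congr (_ *: _); ring.
  split=> //; rewrite {1}/power iterS -/(power _ _) e cd_mulZl cd_mulZr (cd_mul1r _).2.
  by rewrite scalerA exprS; congr (_ *: _); rewrite [in RHS]exprS; ring.
have -> : j = (odd j + j./2.*2)%N by rewrite odd_double_half.
case: (odd j) (j./2) => k; rewrite /cos_coeff /sin_coeff.
  rewrite add1n (pw k).2 /= odd_double doubleK /= !mul0r scale0r add0r scalerA.
  by rewrite mul1r; congr (_ *: _); rewrite mulrC.
rewrite add0n (pw k).1 /= odd_double doubleK !mul0r scale0r addr0 scalerA.
by rewrite mul1r; congr (_ *: _); rewrite mulrC.
Qed.

End Algebra.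

(** * Continuity of the algebra operations and the exponential on a slice *)

Section Continuity.
Variable R : realType.

Lemma cvg_re n (T : Type) (F : set_system T) {FF : Filter F}
  (f : T -> cd R n) (q : cd R n) : f @ F --> q -> re (f u) @[u --> F] --> re q.
Proof.
elim: n f q => [|n IH] f q //= fq.
by apply: IH; apply: cvg_comp fq _; exact: cvg_fst.
Qed.

Lemma cvg_conj n (T : Type) (F : set_system T) {FF : Filter F}
  (f : T -> cd R n) (q : cd R n) :
  f @ F --> q -> cd_conj (f u) @[u --> F] --> cd_conj q.
Proof.
elim: n f q => [|n IH] f q //= fq.
apply: cvg_pair; first by apply: IH; apply: cvg_comp fq _; exact: cvg_fst.
by apply: cvgN; apply: cvg_comp fq _; exact: cvg_snd.
Qed.

Lemma cvg_mul n (T : Type) (F : set_system T) {FF : Filter F}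
  (f g : T -> cd R n) (p q : cd R n) : f @ F --> p -> g @ F --> q ->
  cd_mul (f u) (g u) @[u --> F] --> cd_mul p q.
Proof.
elim: n f g p q => [|n IH] f g p q fp gq /=; first exact: cvgM.
have f1 : (f u).1 @[u --> F] --> p.1 by apply: cvg_comp fp _; exact: cvg_fst.
have f2 : (f u).2 @[u --> F] --> p.2 by apply: cvg_comp fp _; exact: cvg_snd.
have g1 : (g u).1 @[u --> F] --> q.1 by apply: cvg_comp gq _; exact: cvg_fst.
have g2 : (g u).2 @[u --> F] --> q.2 by apply: cvg_comp gq _; exact: cvg_snd.
by apply: cvg_pair; [apply: cvgB|apply: cvgD]; apply: IH => //; exact: cvg_conj.
Qed.

Variable n : nat.

Section Filter.
Variables (T : Type) (F : set_system T).
Context {FF : ProperFilter F}.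
Variables (f : T -> cd R n) (q : cd R n).
Hypothesis fq : f @ F --> q.

Lemma cvg_modulus : modulus (f u) @[u --> F] --> modulus q.
Proof.
have h : re (cd_mul (f u) (cd_conj (f u))) @[u --> F] --> re (cd_mul q (cd_conj q)).
  by apply: cvg_re; apply: cvg_mul => //; exact: cvg_conj.
by apply: cvg_comp h _; exact: sqrt_continuous.
Qed.

Lemma cvg_im : im (f u) @[u --> F] --> im q.
Proof.
by apply: cvgB => //; apply: cvgZ; [exact: cvg_re | exact: cvg_cst].
Qed.

(** The equation I I = -1 passes to the limit. This keeps limits of [unit_im] at real points away
    from 0. *)
Lemma closed_sphere : (\forall u \near F, sphere (f u)) -> sphere q.
Proof.
move=> fs; apply: (@cvg_unique _ _ (cd_mul (f u) (f u) @[u --> F])) => //.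
  exact: cvg_mul.
have /cvg_near_cst : \forall u \near F, cd_mul (f u) (f u) = - cd_one R n by [].
exact.
Qed.

End Filter.

Section FilterIm.
Variables (T : Type) (F : set_system T).
Context {FF : ProperFilter F}.
Variables (f : T -> cd R n) (q : cd R n).
Hypothesis fq : f @ F --> q.

Let cvg_modulus_im : modulus (im (f u)) @[u --> F] --> modulus (im q).
Proof. by apply: cvg_modulus; exact: cvg_im. Qed.

Lemma cvg_unit_im : ~ reals q -> unit_im (f u) @[u --> F] --> unit_im q.
Proof.
move=> /modulus_im_gt0 q0.
by apply: cvgZ; [apply: cvgV => //; rewrite gt_eqF | exact: cvg_im].
Qed.

Lemma cvg_arg : ~ reals q -> arg (f u) @[u --> F] --> arg q.
Proof.
move=> /modulus_im_gt0 q0; apply: cvgB; first exact: cvg_cst.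
have h : re (f u) / modulus (im (f u)) @[u --> F] --> re q / modulus (im q).
  by apply: cvgM; [exact: cvg_re | apply: cvgV => //; rewrite gt_eqF].
by apply: cvg_comp h _; exact: continuous_atan.
Qed.

Lemma cvg_modulus_im0 : reals q -> modulus (im (f u)) @[u --> F] --> (0 : R).
Proof. by move=> /realsP q0; rewrite -(modulus0 R n) -q0. Qed.

End FilterIm.

Lemma exponential_sphere (c : R) (I : cd R n) : sphere I ->
  exponential (c *: I) = cos c *: cd_one R n + sin c *: I.
Proof.
move=> II; apply/cvg_lim; first exact: norm_hausdorff.
have -> : series (fun j : nat => (j`!%:R : R)^-1 *: power (c *: I) j) =
   fun j => series (cos_coeff c) j *: cd_one R n + series (sin_coeff c) j *: I.
  apply/funext => j; rewrite /series /= !scaler_suml -big_split /=.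
  by apply: eq_bigr => i _; exact: power_sphere.
rewrite cos.unlock sin.unlock.
by apply: cvgD; apply: cvgZr_tmp;
  [exact: is_cvg_series_cos_coeff | exact: is_cvg_series_sin_coeff].
Qed.

End Continuity.

(** * Periodicity and the inverse cotangent *)

Section Trigonometry.
Variable R : realType.
Implicit Types (x y : R) (m : int).

Lemma periodicz (U V : zmodType) (f : U -> V) (T : U) : periodic f T ->
  forall m u, f (u + T *~ m) = f u.
Proof.
move=> fT [k|k] u; first by rewrite -pmulrn periodicn.
by rewrite NegzE mulrNz -[in RHS](subrK (T *~ k.+1) u) -pmulrn periodicn.
Qed.

Lemma cosD2piz x m : cos (x + 2 * m%:~R * pi) = cos x.
Proof.
rewrite -(periodicz (@cosD2pi R) m x); congr (cos (_ + _)).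
by rewrite -mulrzr -mulr_natl; ring.
Qed.

Lemma sinD2piz x m : sin (x + 2 * m%:~R * pi) = sin x.
Proof.
rewrite -(periodicz (@sinD2pi R) m x); congr (sin (_ + _)).
by rewrite -mulrzr -mulr_natl; ring.
Qed.

Lemma sin_acot_gt0 x : 0 < sin (acot x).
Proof. by have [h1 h2 _] := acotP x; apply: sin_gt0_pi; rewrite h1. Qed.

Lemma acot_cot x : 0 < x < pi -> acot (cos x / sin x) = x.
Proof.
move=> /andP[x0 xpi]; rewrite /acot.
have -> : cos x / sin x = tan (- x + pi / 2).
  by rewrite /tan sinDpihalf cosDpihalf sinN cosN opprK.
rewrite tanK; first by ring.
by rewrite in_itv /=; apply/andP; split; lra.
Qed.

(** Removing full turns brings x into [0, 2 pi); a positive sine then excludes 0 and [pi, 2 pi), and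
    on (0, pi) the function [acot] inverts the cotangent. *)
Lemma acot_cotz x : 0 < sin x ->
  exists m, x = acot (cos x / sin x) + 2 * m%:~R * pi.
Proof.
have pi0 := pi_gt0 R; pose m := Num.floor (x / (2 * pi)); move=> s0; exists m.
have /andP[m1 m2] := floor_itv (x / (2 * pi)).
rewrite -/m in m1 m2; rewrite ler_pdivlMr ?mulr_gt0// in m1.
rewrite ltr_pdivrMr ?mulr_gt0// intrD in m2.
pose y := x - 2 * m%:~R * pi.
have xE : x = y + 2 * m%:~R * pi by rewrite subrK.
move: s0; rewrite xE cosD2piz sinD2piz => s0; rewrite acot_cot //.
have y_neq0 : y != 0 by apply: contraTneq s0 => ->; rewrite sin0 ltxx.
have y_ge0 : 0 <= y by rewrite /y; lra.
rewrite lt_neqAle eq_sym y_neq0 y_ge0 /= ltNge; apply: contraTN s0 => ypi.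
rewrite -leNgt -(subrK pi y) sinDpi oppr_le0; apply: sin_ge0_pi.
by rewrite subr_ge0 ypi /y; lra.
Qed.

(** Near the real axis the quotient of the real part by the modulus of the imaginary part is
    unbounded. Passing to its inverse replaces a limit at infinity by continuity of [atan] at 0. *)
Lemma acotV_gt0 x : 0 < x -> acot x = atan x^-1.
Proof.
move=> x0; have := atan_ltpi2 x; have := lt_atan x0; rewrite atan0 => h1 h2.
rewrite -(@tanK _ (acot x)); last by rewrite in_itv /= /acot; apply/andP; split; lra.
have [_ _ e] := acotP x; congr atan; rewrite /tan -[in RHS]e invf_div//.
Qed.

Lemma acotV_lt0 x : x < 0 -> acot x = pi + atan x^-1.
Proof.
move=> x0; have := @acotV_gt0 (- x); rewrite oppr_gt0 => /(_ x0).
by rewrite /acot invrN !atanN => h; lra.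
Qed.

End Trigonometry.

(** * From branch indices to numbers of turns *)

Section Winding.

(* [Arg k] is [2 * winding k * pi] above the principal branch, measured along
   the unit of the imaginary part; [k] and [- k - 1] name the same branch. *)
Definition winding (k : int) : int :=
  if (2 %| k)%Z then (k %/ 2)%Z else - (k %/ 2)%Z - 1.

Lemma winding_even l : winding (2 * l) = l.
Proof. by rewrite /winding dvdz_mulr// mulKz. Qed.

Lemma winding_odd l : winding (2 * l + 1) = - l - 1.
Proof.
have d2 : ((2 * l + 1) %/ 2)%Z = l by rewrite mulrC divzMDl// addr0.
have n2 : (2 %| 2 * l + 1)%Z = false.
  by apply/dvdz_mod0P; rewrite mulrC modzMDl.
by rewrite /winding n2 d2.
Qed.

Lemma int_parity (k : int) : exists l, k = 2 * l \/ k = 2 * l + 1.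
Proof.
exists (k %/ 2)%Z; have := divz_eq k 2.
have := modz_ge0 k (isT : (2 : int) != 0); have := ltz_pmod k (isT : (0 : int) < 2).
by move: (k %/ 2)%Z (k %% 2)%Z => q r; lia.
Qed.

Lemma sign_even l : (-1 : int) ^ (2 * l) = 1.
Proof. by rewrite -exprz_exp (_ : (-1) ^ 2 = 1) ?exp1rz. Qed.

Lemma sign_odd l : (-1 : int) ^ (2 * l + 1) = -1.
Proof. by rewrite exprzDr ?unitrN1// sign_even mul1r expr1z. Qed.

Lemma winding_stepN k : winding (k - (-1) ^ k) = - winding k.
Proof.
have [l [->|->]] := int_parity k.
  rewrite sign_even winding_even.
  by rewrite (_ : 2 * l - 1 = 2 * (l - 1) + 1) ?winding_odd; lia.
rewrite sign_odd winding_odd.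
by rewrite (_ : 2 * l + 1 - -1 = 2 * (l + 1)) ?winding_even; lia.
Qed.

Lemma winding_stepD k : winding (k + (-1) ^ k) = - winding k - 1.
Proof.
have [l [->|->]] := int_parity k.
  by rewrite sign_even winding_even winding_odd.
rewrite sign_odd winding_odd.
by rewrite (_ : 2 * l + 1 + -1 = 2 * l) ?winding_even; lia.
Qed.

Lemma Arg_winding (R : realType) n (q : cd R n) k :
  Arg k q = (arg q + 2 * (winding k)%:~R * pi) *: unit_im q.
Proof.
have [l [->|->]] := int_parity k; first by rewrite Arg_even winding_even.
rewrite Arg_odd winding_odd -scaleNr; congr (_ *: _).
by rewrite intrB intrN; ring.
Qed.

End Winding.

(** * Points of the logarithm manifold and limits of the branches *)

Section LogManifold.
Variables (R : realType) (n : nat).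
Implicit Types (q p I : cd R n).

Lemma log_manifold_polar q (r x : R) I : 0 < r -> sphere I ->
  q = r *: (cos x *: cd_one R n + sin x *: I) -> log_manifold (q, x *: I).
Proof.
move=> r0 II ->; exists r, (x *: I); split=> //.
  by have [I0 _] := (sphereE I).1 II; rewrite /imaginary /= reZ I0 mulr0.
by rewrite exponential_sphere.
Qed.

Lemma log_manifold_Arg q k : ~ reals q -> log_manifold (q, Arg k q).
Proof.
move=> qR; have m0 := modulus_im_gt0 qR; have s0 := sin_acot_gt0 (re q / modulus (im q)).
rewrite Arg_winding.
(* This radius is the Euclidean norm of q, written so that the cotangent of [arg q] gives the real
   part directly. *)
apply: (@log_manifold_polar _ (modulus (im q) / sin (arg q))).
- by rewrite divr_gt0.
- exact: unit_im_sphere.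
have [_ _ e] := acotP (re q / modulus (im q)).
rewrite -/(arg q) in e s0; rewrite cosD2piz sinD2piz {1}[q]reimE {1}(im_unit_im qR).
move: (unit_im q) => I; rewrite scalerDr !scalerA; congr (_ *: _ + _ *: _).
  by rewrite mulrAC -mulrA e; field; rewrite gt_eqF.
by field; rewrite gt_eqF.
Qed.

(** Write p = |p| I. The imaginary part of exp p is sin |p| I, which is nonzero because q is not
    real. The sign of the sine decides whether the unit of q is I or - I; in the second case p is
    read as (- |p|) (- I), so that the sine becomes positive. *)
Lemma log_manifold_nonreal q p : ~ reals q -> log_manifold (q, p) ->
  exists m : int, p = (arg q + 2 * m%:~R * pi) *: unit_im q.
Proof.
move=> qR [r [p' [r0 p'0 [qE ->]]]] {p}; rename p' into p.
have one_sphere x I : sphere I -> p = x *: I -> 0 < sin x ->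
    exists m : int, p = (arg q + 2 * m%:~R * pi) *: unit_im q.
  move=> II pE s0; move: qE; rewrite pE exponential_sphere// scalerDr !scalerA.
  have rs0 : 0 < r * sin x by rewrite mulr_gt0.
  move=> qE; have /= := unit_imE (r * cos x) rs0 II; rewrite -qE => -[e1 e2 e3].
  have [m xE] := acot_cotz s0; exists m; rewrite e3; congr (_ *: _).
  by rewrite /arg e1 e2 -mulf_div divff ?mul1r ?gt_eqF.
have p_neq0 : p != 0.
  (* Writing 0 as 0 times some unit makes the slice formula for the exponential applicable;
     [unit_im q] is a unit at hand. *)
  apply/eqP => p0; apply: (qR); exists r; rewrite qE p0 -(scale0r (unit_im q)).
  by rewrite exponential_sphere ?cos0 ?sin0 ?scale1r ?scale0r ?addr0//; exact: unit_im_sphere.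
have [I II pE] := imaginary_polar p'0 p_neq0.
have [s0|s0|s0] := ltgtP (sin (modulus p)) 0; last 1 first.
- exfalso; apply: qR; exists (r * cos (modulus p)).
  by rewrite qE pE exponential_sphere// -pE s0 scale0r addr0 scalerA.
- apply: (@one_sphere (- modulus p) (- I)); first exact: sphereN.
    by rewrite scalerN scaleNr opprK.
  by rewrite sinN oppr_gt0.
exact: one_sphere II pE s0.
Qed.

(* The real number [m] with [p = (arg q + 2 * m * pi) *: unit_im q], if any. *)
Definition turns q p : R :=
  (re (cd_mul p (cd_conj (unit_im q))) - arg q) / (2 * pi).

Lemma turns_branch q (x : R) : ~ reals q ->
  turns q ((arg q + 2 * x * pi) *: unit_im q) = x.
Proof.
move=> qR; rewrite /turns re_mul_conj_sphere; last exact: unit_im_sphere.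
by have := pi_gt0 R; move: (pi : R) => w w0; field; rewrite gt_eqF.
Qed.

Section Limits.
Variables (T : Type) (F : set_system T).
Context {FF : ProperFilter F}.
Variables (f : T -> cd R n) (q : cd R n).
Hypothesis fq : f @ F --> q.

Lemma cvg_Arg k : ~ reals q -> Arg k (f u) @[u --> F] --> Arg k q.
Proof.
move=> qR; rewrite Arg_winding; under eq_fun do rewrite Arg_winding.
apply: cvgZ; last exact: cvg_unit_im.
by apply: cvgD; [exact: cvg_arg | exact: cvg_cst].
Qed.

Lemma cvg_turns (P : T -> cd R n) p : P @ F --> p -> ~ reals q ->
  turns (f u) (P u) @[u --> F] --> turns q p.
Proof.
move=> Pp qR; apply: cvgM; last exact: cvg_cst.
apply: cvgB; last exact: cvg_arg.
by apply: cvg_re; apply: cvg_mul => //; apply: cvg_conj; exact: cvg_unit_im.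
Qed.

Hypotheses (qR : reals q) (q0 : q != 0) (fR : \forall u \near F, ~ reals (f u)).

(** The function [arg] cannot play this role: at a real point its quotient is a division by 0, hence
    0 by convention, and [arg] returns pi / 2. *)
Definition real_arg (q : cd R n) : R := if 0 < re q then 0 else pi.

Lemma re_neq0 : re q != 0.
Proof.
apply: contra_neq q0 => re0.
by rewrite [q]reimE re0 scale0r ((realsP q).1 qR) addr0.
Qed.

(** The modulus of the imaginary part divided by the real part tends to 0, and on either side of 0
    [arg] is the arctangent of this quotient, shifted by pi when the real part is negative. *)
Lemma cvg_arg_real : arg (f u) @[u --> F] --> real_arg q.
Proof.
have cre : re (f u) @[u --> F] --> re q by exact: cvg_re.
have catan : atan (re (f u) / modulus (im (f u)))^-1 @[u --> F] --> (0 : R).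
  rewrite -(atan0 R).
  have h : (re (f u) / modulus (im (f u)))^-1 @[u --> F] --> (0 : R).
    under eq_fun do rewrite invf_div.
    rewrite -(mul0r (re q)^-1); apply: cvgM; first exact: (cvg_modulus_im0 fq qR).
    by apply: cvgV => //; exact: re_neq0.
  by apply: cvg_comp h _; exact: continuous_atan.
rewrite /real_arg; have [re0|] := ltP 0 (re q).
  apply: cvg_trans catan; apply: near_eq_cvg.
  near=> u; rewrite /arg acotV_gt0//; apply: divr_gt0.
    by near: u; exact: (cvgr_gt _ cre).
  by apply: modulus_im_gt0; near: u.
rewrite le_eqVlt (negbTE re_neq0) /= => re0.
rewrite -[pi]addr0.
have : pi + atan (re (f u) / modulus (im (f u)))^-1 @[u --> F] --> pi + (0 : R).
  by apply: cvgD => //; exact: cvg_cst.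
apply: cvg_trans; apply: near_eq_cvg.
near=> u; rewrite /arg acotV_lt0//; rewrite pmulr_llt0.
  by near: u; exact: (cvgr_lt _ cre).
by rewrite invr_gt0; apply: modulus_im_gt0; near: u.
Unshelve. all: by end_near. Qed.

Lemma cvg_Arg_real k I : unit_im (f u) @[u --> F] --> I ->
  Arg k (f u) @[u --> F] --> (real_arg q + 2 * (winding k)%:~R * pi) *: I.
Proof.
move=> fI; under eq_fun do rewrite Arg_winding.
by apply: cvgZ => //; apply: cvgD; [exact: cvg_arg_real | exact: cvg_cst].
Qed.

Lemma limit_unit_im_sphere I : unit_im (f u) @[u --> F] --> I -> sphere I.
Proof.
move=> fI; apply: (closed_sphere fI); near=> u.
by apply: unit_im_sphere; near: u.
Unshelve. all: by end_near. Qed.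

End Limits.

(** The sine vanishes at this angle, so I drops out of the exponential and may be any unit; the
    cosine is the sign of [re q]. *)
Lemma log_manifold_real q I k : reals q -> q != 0 -> sphere I ->
  log_manifold (q, (real_arg q + 2 * (winding k)%:~R * pi) *: I).
Proof.
move=> qR q0 II; have := re_neq0 qR q0 => r0.
apply: (@log_manifold_polar _ `|re q|) => //; first by rewrite normr_gt0.
rewrite {1}[q]reimE ((realsP q).1 qR) addr0 cosD2piz sinD2piz /real_arg.
have [re0|re0] := ltP 0 (re q).
  by rewrite cos0 sin0 scale0r addr0 scale1r gtr0_norm.
by rewrite cospi sinpi scale0r addr0 scaleN1r scalerN -scaleNr ler0_norm// opprK.
Qed.

(** Across a flip I becomes - I, so the coefficient must become its opposite. Twice [real_arg q] is
    0 or 2 pi, and the latter accounts for the extra turn in [winding_stepD]. *)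
Lemma real_arg_step q k : reals q -> q != 0 ->
  real_arg q + 2 * (winding (k - (-1) ^ k * sgz (re q)))%:~R * pi =
  - (real_arg q + 2 * (winding k)%:~R * pi).
Proof.
move=> qR q0; have := re_neq0 qR q0; rewrite /real_arg.
case: sgzP => // re0 _.
  by rewrite mulr1 winding_stepN intrN; ring.
by rewrite mulrN1 opprK winding_stepD intrB intrN; ring.
Qed.

End LogManifold.

(** * Continuity on a set through one-sided limits *)

Section OneSided.
Variables (R : realType) (T : topologicalType).
Implicit Types (D : set R) (f : R -> T) (x : R).

Lemma within_continuous_right D f x : {within D, continuous f} -> D x ->
  (\forall u \near x^'+, D u) -> f u @[u --> x^'+] --> f x.
Proof.
move=> /subspace_continuousP/(_ x) + Dx near_D => /(_ Dx) fx.
apply: cvg_trans fx => A; rewrite /within /= => fA.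
have near_D' : \forall u \near x, x < u -> D u by exact: near_D.
suff : \forall u \near x, x < u -> A (f u) by [].
by apply: filterS2 near_D' fA => u Du fA /Du /fA.
Qed.

Lemma within_continuous_left D f x : {within D, continuous f} -> D x ->
  (\forall u \near x^'-, D u) -> f u @[u --> x^'-] --> f x.
Proof.
move=> /subspace_continuousP/(_ x) + Dx near_D => /(_ Dx) fx.
apply: cvg_trans fx => A; rewrite /within /= => fA.
have near_D' : \forall u \near x, u < x -> D u by exact: near_D.
suff : \forall u \near x, u < x -> A (f u) by [].
by apply: filterS2 near_D' fA => u Du fA /Du /fA.
Qed.

(** The first alternative in each hypothesis serves the endpoints of an interval, beyond which D has
    no nearby points. *)
Lemma one_sided_within_continuous D f :
  (forall x, D x -> (\forall u \near x^'-, ~ D u) \/ f u @[u --> x^'-] --> f x) ->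
  (forall x, D x -> (\forall u \near x^'+, ~ D u) \/ f u @[u --> x^'+] --> f x) ->
  {within D, continuous f}.
Proof.
move=> fl fr; apply/subspace_continuousP => x Dx A fA; rewrite /= /within /=.
have sl : \forall u \near x, u < x -> D u -> A (f u).
  have [h|/(_ A fA) h] := fl x Dx.
    have h' : \forall u \near x, u < x -> ~ D u by [].
    by apply: filterS h' => u h' /h'.
  have h' : \forall u \near x, u < x -> A (f u) by [].
  by apply: filterS h' => u h' /h'.
have sr : \forall u \near x, x < u -> D u -> A (f u).
  have [h|/(_ A fA) h] := fr x Dx.
    have h' : \forall u \near x, x < u -> ~ D u by [].
    by apply: filterS h' => u h' /h'.
  have h' : \forall u \near x, x < u -> A (f u) by [].
  by apply: filterS h' => u h' /h'.
apply: filterS2 sl sr => u hl hr Du.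
have [ux|xu|->] := ltgtP u x; [exact: hl | exact: hr |].
exact: nbhs_singleton fA.
Qed.

End OneSided.

(** * Lifts between real points, and their extension *)

Section Lifts.
Variables (R : realType) (n : nat) (gamma : R -> cd R n).
Implicit Types (c d : R) (k : int).

(** Off the real axis [turns] is continuous, and along a lift it takes integer values; on an
    interval it is therefore constant. *)
Lemma gap_winding (P : R -> cd R n) c d :
  {in `]c, d[, continuous gamma} -> {in `]c, d[, continuous P} ->
  (forall s, s \in `]c, d[ -> ~ reals (gamma s)) ->
  (forall s, s \in `]c, d[ -> log_manifold (gamma s, P s)) ->
  exists m : int, forall s, s \in `]c, d[ ->
    P s = (arg (gamma s) + 2 * m%:~R * pi) *: unit_im (gamma s).
Proof.
move=> gC PC gR gL; have pi0 := pi_gt0 R.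
have [c_lt_d|dc] := ltP c d; last first.
  by exists 0 => s; rewrite in_itv /= => /andP[cs /(lt_trans cs)]; rewrite ltNge dc.
pose h s := turns (gamma s) (P s).
have hm s : s \in `]c, d[ -> exists2 m : int, h s = m%:~R &
    P s = (arg (gamma s) + 2 * m%:~R * pi) *: unit_im (gamma s).
  move=> sI; have [m PE] := log_manifold_nonreal (gR s sI) (gL s sI).
  by exists m => //; rewrite /h PE turns_branch//; exact: gR.
have hC : {in `]c, d[, continuous h}.
  move=> s sI; apply: (cvg_turns (FF := nbhs_pfilter s)).
  - exact: gC.
  - exact: PC.
  - exact: gR.
have mono x y : x \in `]c, d[ -> y \in `]c, d[ -> x <= y -> h x = h y.
  move=> xI yI xy; have [mx hx _] := hm x xI; have [my hy _] := hm y yI.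
  rewrite hx hy; have [-> //|mxy] := eqVneq mx my.
  have hCxy : {within `[x, y], continuous h}.
    apply: continuous_in_subspaceT => z /set_mem /=; rewrite in_itv /= => /andP[xz zy].
    apply: hC; move: xI yI; rewrite !in_itv /= => /andP[cx _] /andP[_ yd].
    by rewrite (lt_le_trans cx xz) (le_lt_trans zy yd).
  (* Half a unit above the smaller of two distinct integers lies between them and is not an integer;
     doubling it will yield an odd number equal to an even one. *)
  have [|z zxy hz] := @IVT R h x y ((Num.min mx my)%:~R + 2^-1) xy hCxy.
    rewrite hx hy.
    have [lt|lt] : (mx + 1 <= my) \/ (my + 1 <= mx) by lia.
      have lt' := lt; rewrite -(ler_int R) intrD in lt'.
      have -> : Num.min mx my = mx by lia.
      by rewrite min_l ?max_r; [apply/andP; split|..]; lra.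
    have lt' := lt; rewrite -(ler_int R) intrD in lt'.
    have -> : Num.min mx my = my by lia.
    by rewrite min_r ?max_l; [apply/andP; split|..]; lra.
  have zI : z \in `]c, d[.
    move: zxy xI yI; rewrite !in_itv /= => /andP[xz zy] /andP[cx _] /andP[_ yd].
    by rewrite (lt_le_trans cx xz) (le_lt_trans zy yd).
  have [mz + _] := hm z zI; rewrite hz => e.
  have : ((2 * Num.min mx my + 1)%:~R : R) = (2 * mz)%:~R.
    by rewrite intrD !intrM -e; field.
  by move/intr_inj; lia.
have mid : (c + d) / 2 \in `]c, d[ by rewrite in_itv /=; apply/andP; split; lra.
have [m hmid _] := hm _ mid; exists m => s sI.
have [m' hs ->] := hm s sI; suff -> : m' = m by [].
apply: (@intr_inj R); rewrite -hs -hmid.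
by have [le|/ltW le] := leP s ((c + d) / 2); [|symmetry]; exact: mono.
Qed.

(** If P were another branch, its difference with [Arg k] would be a fixed nonzero multiple of
    [unit_im]. Since both tend to v, [unit_im] would tend to 0, whereas a limit of units is a unit.
    Convergence of [unit_im] at c is not presupposed. *)
Lemma gap_unique (P : R -> cd R n) c d k (v : cd R n) :
  {in `]c, d[, continuous gamma} -> {in `]c, d[, continuous P} ->
  (forall s, s \in `]c, d[ -> ~ reals (gamma s)) ->
  (forall s, s \in `]c, d[ -> log_manifold (gamma s, P s)) ->
  P u @[u --> c^'+] --> v -> Arg k (gamma u) @[u --> c^'+] --> v ->
  forall s, s \in `]c, d[ -> P s = Arg k (gamma s).
Proof.
move=> gC PC gR gL Pv kv s sI; have [m PE] := gap_winding gC PC gR gL.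
rewrite PE// Arg_winding; congr ((_ + 2 * _%:~R * _) *: _).
have c_lt_d : c < d by move: sI; rewrite in_itv /= => /andP[]; exact: lt_trans.
apply/eqP/negPn/negP => mk.
pose e : R := 2 * (m - winding k)%:~R * pi.
have e0 : e != 0.
  by rewrite /e !mulf_eq0 !negb_or pnatr_eq0 intr_eq0 subr_eq0 mk (gt_eqF (pi_gt0 R)).
have : e *: unit_im (gamma u) @[u --> c^'+] --> (0 : cd R n).
  rewrite -(subrr v); have : P u - Arg k (gamma u) @[u --> c^'+] --> v - v by exact: cvgB.
  apply: cvg_trans; apply: near_eq_cvg; near=> u.
  rewrite PE ?Arg_winding -?scalerBl; last first.
    rewrite in_itv /=; apply/andP.
    by split; near: u; [exact: nbhs_right_gt | exact: nbhs_right_lt].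
  by congr (_ *: _); rewrite /e intrB; ring.
move/(cvgZl_tmp (k := e^-1)); rewrite scaler0 => h.
have uI : unit_im (gamma u) @[u --> c^'+] --> (0 : cd R n).
  by move: h; apply: cvg_trans; apply: near_eq_cvg; apply: nearW => u /=;
    rewrite scalerA mulVf// scale1r.
have /sphere_neq0/eqP : sphere (0 : cd R n); last by [].
apply: (closed_sphere uI); near=> u; apply: unit_im_sphere; apply: gR.
rewrite in_itv /=; apply/andP.
by split; near: u; [exact: nbhs_right_gt | exact: nbhs_right_lt].
Unshelve. all: by end_near. Qed.

(** The two pieces match at c because the new branch tends from the right to the value already
    reached; elsewhere continuity is inherited from one piece. *)
Lemma extend_lift_open (Gamma : R -> cd R n * cd R n) a c d k :
  a <= c -> c < d ->
  {in `]c, d[, continuous gamma} -> gamma u @[u --> c^'+] --> gamma c ->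
  (forall s, s \in `]c, d[ -> ~ reals (gamma s)) ->
  is_lift gamma `[a, c] Gamma ->
  Arg k (gamma u) @[u --> c^'+] --> (Gamma c).2 ->
  is_lift gamma `[a, d[ (fun s => if s <= c then Gamma s else (gamma s, Arg k (gamma s))).
Proof.
move=> ac c_lt_d gC gc gR [GC GL] kc; set G : R -> cd R n * cd R n := fun s => _.
have Gle s : s <= c -> G s = Gamma s by rewrite /G => ->.
have Ggt s : c < s -> G s = (gamma s, Arg k (gamma s)) by rewrite /G leNgt => ->.
split; last first.
  move=> s; rewrite /= in_itv /= => /andP[as_ sd]; have [sc|cs] := leP s c.
    by rewrite Gle//; apply: GL; rewrite /= in_itv /= as_ sc.
  by rewrite Ggt//; split=> //; apply/log_manifold_Arg/gR; rewrite in_itv /= cs sd.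
have Gin x : c < x -> x < d -> G u @[u --> x] --> G x.
  move=> cx xd; rewrite Ggt//.
  have gx : gamma u @[u --> x] --> gamma x by apply: gC; rewrite in_itv /= cx xd.
  have : (gamma u, Arg k (gamma u)) @[u --> x] --> (gamma x, Arg k (gamma x)).
    apply: cvg_pair => //; apply: (cvg_Arg (FF := nbhs_pfilter x)) => //; apply: gR.
    by rewrite in_itv /= cx xd.
  apply: cvg_trans; apply: near_eq_cvg; near=> u.
  by rewrite Ggt//; near: u; exact: lt_nbhsr.
apply: one_sided_within_continuous => x; rewrite /= in_itv /= => /andP[ax xd].
  have [xc|cx] := leP x c; last by right; apply: cvg_at_left_filter; exact: Gin.
  move: ax; rewrite le_eqVlt => /predU1P[<-|ax]; [left|right].
    near=> u; rewrite in_itv /= => /andP[au _].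
    by have : u < a; [near: u; exact: nbhs_left_lt | rewrite ltNge au].
  rewrite Gle//; have : Gamma u @[u --> x^'-] --> Gamma x.
    apply: (within_continuous_left GC); first by rewrite /= in_itv /= ltW.
    near=> u; rewrite /= in_itv /=; apply/andP; split; near: u.
      by apply: nbhs_left_ge.
    by apply: filterS (nbhs_left_lt x) => u /ltW /le_trans; exact.
  apply: cvg_trans; apply: near_eq_cvg; near=> u.
  by rewrite Gle// (le_trans _ xc)// ltW//; near: u; exact: nbhs_left_lt.
right; have [xc|cx|xc] := ltgtP x c.
- rewrite Gle ?ltW//; have : Gamma u @[u --> x^'+] --> Gamma x.
    apply: (within_continuous_right GC); first by rewrite /= in_itv /= ax ltW.
    near=> u; rewrite /= in_itv /=; apply/andP; split; near: u.
      by apply: filterS (nbhs_right_gt x) => u /ltW; exact: le_trans.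
    by apply: nbhs_right_le.
  apply: cvg_trans; apply: near_eq_cvg; near=> u.
  by rewrite Gle//; near: u; exact: nbhs_right_le.
- by apply: cvg_at_right_filter; exact: Gin.
have [|_ Gc1] := GL c; first by rewrite /= in_itv /= ac lexx.
rewrite xc Gle// [Gamma c]surjective_pairing Gc1.
have : (gamma u, Arg k (gamma u)) @[u --> c^'+] --> (gamma c, (Gamma c).2).
  exact: cvg_pair.
apply: cvg_trans; apply: near_eq_cvg; near=> u.
by rewrite Ggt//; near: u; exact: nbhs_right_gt.
Unshelve. all: by end_near. Qed.

Lemma extend_lift_closed (Gamma : R -> cd R n * cd R n) a d (v : cd R n) :
  a < d -> gamma u @[u --> d^'-] --> gamma d ->
  is_lift gamma `[a, d[ Gamma -> (Gamma u).2 @[u --> d^'-] --> v ->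
  log_manifold (gamma d, v) ->
  is_lift gamma `[a, d] (fun s => if s < d then Gamma s else (gamma d, v)).
Proof.
move=> ad gd [GC GL] Gv vL; set G : R -> cd R n * cd R n := fun s => _.
have Glt s : s < d -> G s = Gamma s by rewrite /G => ->.
have Gd : G d = (gamma d, v) by rewrite /G ltxx.
split; last first.
  move=> s; rewrite /= in_itv /= => /andP[as_]; rewrite le_eqVlt => /predU1P[->|sd].
    by rewrite Gd.
  by rewrite Glt//; apply: GL; rewrite /= in_itv /= as_ sd.
apply: one_sided_within_continuous => x; rewrite /= in_itv /= => /andP[ax];
    rewrite le_eqVlt => /predU1P[->|xd].
- right; rewrite Gd.
  have : (gamma u, (Gamma u).2) @[u --> d^'-] --> (gamma d, v) by exact: cvg_pair.
  apply: cvg_trans; apply: near_eq_cvg; near=> u.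
  have ud : u < d by near: u; exact: nbhs_left_lt.
  have [|_ <-] := GL u; last by rewrite Glt// -surjective_pairing.
  by rewrite /= in_itv /= ud andbT; near: u; exact: nbhs_left_ge.
- move: ax; rewrite le_eqVlt => /predU1P[<-|ax]; [left|right].
    near=> u; rewrite in_itv /= => /andP[au _].
    by have : u < a; [near: u; exact: nbhs_left_lt | rewrite ltNge au].
  rewrite Glt//; have : Gamma u @[u --> x^'-] --> Gamma x.
    apply: (within_continuous_left GC); first by rewrite /= in_itv /= ltW.
    near=> u; rewrite /= in_itv /=; apply/andP; split; near: u.
      by apply: nbhs_left_ge.
    by apply: filterS (nbhs_left_lt x) => u /lt_trans; exact.
  apply: cvg_trans; apply: near_eq_cvg; near=> u.
  by rewrite Glt// (lt_trans _ xd)//; near: u; exact: nbhs_left_lt.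
- left; near=> u; rewrite in_itv /= => /andP[_ ud].
  by have : d < u; [near: u; exact: nbhs_right_gt | rewrite ltNge ud].
right; rewrite Glt//; have : Gamma u @[u --> x^'+] --> Gamma x.
  apply: (within_continuous_right GC); first by rewrite /= in_itv /= ax xd.
  near=> u; rewrite /= in_itv /=; apply/andP; split; near: u.
    by apply: filterS (nbhs_right_gt x) => u /ltW; exact: le_trans.
  by apply: nbhs_right_lt.
apply: cvg_trans; apply: near_eq_cvg; near=> u.
by rewrite Glt//; near: u; exact: nbhs_right_lt.
Unshelve. all: by end_near. Qed.

End Lifts.

(** * The change of index at real points and the signature *)

Section Crossings.
Variables (R : realType) (n : nat) (gamma : R -> cd R n) (a b : R).
Implicit Types (s x : R) (k : int) (xs : seq R).

Definition flip_index k s : int := k - (-1) ^ k * sgz (re (gamma s)).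

Definition crossing_index k s : int :=
  if `[< flip gamma a b s >] then flip_index k s else k.

Lemma sign_flip_index k s : re (gamma s) != 0 ->
  (-1 : int) ^ flip_index k s = - (-1) ^ k.
Proof.
rewrite /flip_index; case: sgzP => // _ _; have [l [->|->]] := int_parity k.
- by rewrite sign_even mulr1 (_ : 2 * l - 1 = 2 * (l - 1) + 1) ?sign_odd; lia.
- by rewrite sign_odd mulr1 (_ : 2 * l + 1 - -1 = 2 * (l + 1)) ?sign_even ?opprK; lia.
- by rewrite sign_even mul1r (_ : 2 * l - -1 = 2 * l + 1) ?sign_odd; lia.
- by rewrite sign_odd mulrNN mul1r (_ : 2 * l + 1 - 1 = 2 * l) ?sign_even ?opprK; lia.
Qed.

Lemma foldl_crossing_index k xs :
  foldl crossing_index k xs =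
  foldl flip_index k [seq s <- xs | `[< flip gamma a b s >]].
Proof.
elim: xs k => //= s xs IH k; rewrite IH /crossing_index.
by case: asboolP.
Qed.

(** The index k stays general in the induction: the first flip reverses [(-1) ^ k] for the rest of
    the list, which raises the exponent of each remaining term by one. *)
Lemma foldl_flip_index k xs : {in xs, forall s, re (gamma s) != 0} ->
  foldl flip_index k xs =
  k + (-1) ^ k * \sum_(l < size xs) sgz (re (gamma (xs`_l))) * (-1) ^+ l.+1.
Proof.
elim: xs k => [|s xs IH] k xs0 /=; first by rewrite big_ord0 mulr0 addr0.
rewrite IH => [|u uxs]; last by apply: xs0; rewrite inE uxs orbT.
rewrite sign_flip_index ?xs0 ?mem_head// big_ord_recl /= expr1 /flip_index.
under [in RHS]eq_bigr do rewrite exprS mulrCA.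
by rewrite -mulr_sumr; ring.
Qed.

(** The enumeration in [flips] is meaningful only for a finite set; here every flip occurs in xs.
    Two strictly increasing lists with the same members are equal. *)
Lemma flips_filter xs : sorted <%O xs ->
  (forall s, a < s < b -> reals (gamma s) -> s \in xs) ->
  flips gamma a b = [seq s <- xs | `[< flip gamma a b s >]].
Proof.
move=> xs_sorted xsP.
have fin : finite_set [set s | flip gamma a b s].
  apply: (@sub_finite_set _ _ [set` xs]); last exact: finite_seq.
  by move=> s [sab sR _]; exact: xsP.
apply: lt_sorted_eq.
- by rewrite sort_lt_sorted fset_uniq.
- by apply: sorted_filter => //; exact: lt_trans.
move=> s; rewrite mem_sort mem_filter.
rewrite [LHS](in_fset_set fin) .
apply/idP/andP => [/set_mem h|[/asboolP h _]]; last exact/mem_set.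
by split; [apply/asboolP | case: h => sab sR _; exact: xsP].
Qed.

Lemma crossing s k : reals (gamma s) -> gamma s != 0 ->
  gamma u @[u --> s^'-] --> gamma s -> gamma u @[u --> s^'+] --> gamma s ->
  (\forall u \near s^'-, ~ reals (gamma u)) ->
  (\forall u \near s^'+, ~ reals (gamma u)) ->
  tame_parameter gamma a b s ->
  exists v : cd R n, [/\ Arg k (gamma u) @[u --> s^'-] --> v,
    Arg (crossing_index k s) (gamma u) @[u --> s^'+] --> v
    & log_manifold (gamma s, v)].
Proof.
move=> sR s0 gl gr Rl Rr tame_s.
have [s_flip|s_nflip] := pselect (flip gamma a b s).
  have -> : crossing_index k s = flip_index k s by rewrite /crossing_index asboolT.
  have [_ _ [I Il Ir]] := s_flip.
  have II := limit_unit_im_sphere (FF := at_left_proper_filter s) Rl Il.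
  exists ((real_arg (gamma s) + 2 * (winding k)%:~R * pi) *: I); split.
  - exact: cvg_Arg_real.
  (* The common value c I is rewritten as (- c) (- I), since - I is the limit of the unit on the
     right. *)
  - rewrite -[X in _ --> X]opprK -scalerN -scaleNr -real_arg_step//.
    exact: cvg_Arg_real.
  - exact: log_manifold_real.
have -> : crossing_index k s = k by rewrite /crossing_index asboolF.
case: tame_s => // -[_ _ [I Il Ir]].
have II := limit_unit_im_sphere (FF := at_left_proper_filter s) Rl Il.
exists ((real_arg (gamma s) + 2 * (winding k)%:~R * pi) *: I).
by split; [exact: cvg_Arg_real | exact: cvg_Arg_real | exact: log_manifold_real].
Qed.

End Crossings.

(** * Existence of the continued lift *)

Section Continuation.
Variables (R : realType) (n : nat) (gamma : R -> cd R n) (a b : R).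
Variables (p : nat) (T : nat -> R) (k0 : int) (Gamma : R -> cd R n * cd R n).
Hypothesis a_lt_b : a < b.
Hypothesis gammaC : {within `[a, b], continuous gamma}.
Hypothesis gamma0 : forall s, s \in `[a, b] -> gamma s != 0.
Hypothesis T_lt : forall i j, (i < j <= p)%N -> T i < T j.
Hypothesis T_real : forall i, (i <= p)%N -> T i \in `[a, b] /\ reals (gamma (T i)).
Hypothesis real_T : forall s, s \in `[a, b] -> reals (gamma s) ->
  exists2 i, (i <= p)%N & s = T i.
Hypothesis tameP : forall s, s \in `]a, b[ -> reals (gamma s) ->
  tame_parameter gamma a b s.
Hypothesis Gamma_lift : is_lift gamma `[a, T 0%N] Gamma.
Hypothesis Gamma_Arg :
  Arg k0 (gamma u) @[u --> (if a < T 0%N then (T 0%N)^'- else (T 0%N)^'+)]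
    --> (Gamma (T 0%N)).2.

Let cross := crossing_index gamma a b.
(* The branch followed between [T i] and [next i]. *)
Let index i := foldl cross k0 (mkseq T i.+1).

Let T_ge i : (i <= p)%N -> a <= T i.
Proof. by move=> /T_real[]; rewrite in_itv /= => /andP[]. Qed.

Let T_le i : (i <= p)%N -> T i <= b.
Proof. by move=> /T_real[]; rewrite in_itv /= => /andP[]. Qed.

Let T0_le i : (i <= p)%N -> T 0%N <= T i.
Proof. by case: i => // i ip; apply/ltW/T_lt; rewrite ip. Qed.

Let gamma_right s : a <= s -> s < b -> gamma u @[u --> s^'+] --> gamma s.
Proof.
move=> as_ sb; apply: (within_continuous_right gammaC).
  by rewrite /= in_itv /= as_ ltW.
near=> u; rewrite /= in_itv /=; apply/andP; split; near: u.
  by apply: filterS (nbhs_right_gt s) => u /ltW; exact: le_trans.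
exact: nbhs_right_le.
Unshelve. all: by end_near. Qed.

Let gamma_left s : a < s -> s <= b -> gamma u @[u --> s^'-] --> gamma s.
Proof.
move=> as_ sb; apply: (within_continuous_left gammaC).
  by rewrite /= in_itv /= sb ltW.
near=> u; rewrite /= in_itv /=; apply/andP; split; near: u.
  exact: nbhs_left_ge.
by apply: filterS (nbhs_left_lt s) => u /ltW /le_trans; exact.
Unshelve. all: by end_near. Qed.

Let gamma_gap c d : a <= c -> d <= b -> {in `]c, d[, continuous gamma}.
Proof.
move=> ac db s; rewrite in_itv /= => /andP[cs sd].
apply: (within_continuous_continuous a_lt_b gammaC).
by rewrite in_itv /= (le_lt_trans ac cs) (lt_le_trans sd db).
Qed.

Let next i := if i == p then b else T i.+1.

Let next_le i : (i <= p)%N -> next i <= b.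
Proof. by rewrite /next; case: eqP => // ? ?; apply: T_le; lia. Qed.

Let gap_nonreal i s : (i <= p)%N -> s \in `]T i, next i[ -> ~ reals (gamma s).
Proof.
move=> ip; rewrite in_itv /= => /andP[is_ sn] sR.
have [|j jp sj] := real_T _ sR.
  by rewrite in_itv /= (le_trans (T_ge ip) (ltW is_)) (le_trans (ltW sn) (next_le ip)).
have ij : (i < j)%N.
  rewrite ltnNge leq_eqVlt; apply/negP => /predU1P[ji|ji].
    by move: is_; rewrite sj ji ltxx.
  have ji_le : (j < i <= p)%N by rewrite ji.
  by have := T_lt ji_le; rewrite -sj ltNge (ltW is_).
move: sn; rewrite /next; case: eqP => [?|_]; first by move: ij jp; lia.
rewrite sj ltNge; case: (ltngtP i.+1 j) => [h|h|->]; last by rewrite lexx.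
  by rewrite ltW// T_lt// h.
by move: h ij; lia.
Qed.

(** There are finitely many real parameters, so a filter that avoids each single point avoids all of
    them at once. This covers left and right neighborhoods together. *)
Let near_nonreal (F : set_system R) : ProperFilter F ->
  (forall c, \forall u \near F, u != c) -> (\forall u \near F, u \in `[a, b]) ->
  \forall u \near F, ~ reals (gamma u).
Proof.
move=> FF Fneq Fab.
have : \forall u \near F, forall i : 'I_p.+1, u != T i.
  by apply: filter_forall => i; exact: Fneq.
apply: filterS2 Fab => u uab uT uR; have [i ip uE] := real_T uab uR.
by have := uT (Ordinal (ip : (i < p.+1)%N)); rewrite /= -uE eqxx.
Qed.

Let crossing_at s k : s \in `]a, b[ -> reals (gamma s) ->
  exists v : cd R n, [/\ Arg k (gamma u) @[u --> s^'-] --> v,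
    Arg (cross k s) (gamma u) @[u --> s^'+] --> v & log_manifold (gamma s, v)].
Proof.
move=> sab sR; have := sab; rewrite in_itv /= => /andP[as_ sb].
apply: crossing => //.
- by apply: gamma0; rewrite in_itv /= !ltW.
- by apply: gamma_left => //; exact: ltW.
- by apply: gamma_right => //; exact: ltW.
- apply: near_nonreal => [c|].
    have [cs|sc] := ltP c s.
      by apply: filterS (nbhs_left_gt cs) => u cu; rewrite gt_eqF.
    by apply: filterS (nbhs_left_lt s) => u us; rewrite lt_eqF// (lt_le_trans us).
  near=> u; rewrite in_itv /=; apply/andP; split; near: u; first exact: nbhs_left_ge.
  by apply: filterS (nbhs_left_lt s) => u /ltW /le_trans; apply; exact: ltW.
- apply: near_nonreal => [c|].
    have [cs|sc] := leP c s.
      by apply: filterS (nbhs_right_gt s) => u su; rewrite gt_eqF// (le_lt_trans cs).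
    by apply: filterS (nbhs_right_lt sc) => u us; rewrite lt_eqF.
  near=> u; rewrite in_itv /=; apply/andP; split; near: u; last exact: nbhs_right_le.
  by apply: filterS (nbhs_right_gt s) => u /ltW; apply: le_trans; exact: ltW.
- exact: tameP.
Unshelve. all: by end_near. Qed.

(** If a < T 0, the given lift arrives from the left along [Arg k0], and the crossing carries the
    limit to the right side. If T 0 = a, it is not interior, hence not a flip, and the assumed limit
    is already the right one. *)
Let index0_right : T 0%N < b ->
  Arg (index 0) (gamma u) @[u --> (T 0%N)^'+] --> (Gamma (T 0%N)).2.
Proof.
move=> Tb; rewrite /index /=; move: Gamma_Arg; case: ifPn => [aT|/negP aT].
  have [||v [vl vr _]] := @crossing_at (T 0%N) k0.
  - by rewrite in_itv /= aT.
  - by have [] := T_real (leq0n p).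
  by move=> /(norm_cvg_unique vl) <-.
by rewrite /cross /crossing_index asboolF// => -[/andP[/aT]].
Qed.

Let indexS i : index i.+1 = cross (index i) (T i.+1).
Proof. by rewrite /index mkseqS foldl_rcons. Qed.

Let next_gt i : (i <= p)%N -> T i < b -> T i < next i.
Proof. by rewrite /next; case: eqP => // ip ? _; apply: T_lt; lia. Qed.

Let extend i (G : R -> cd R n * cd R n) : (i <= p)%N -> T i < b ->
  is_lift gamma `[a, T i] G ->
  Arg (index i) (gamma u) @[u --> (T i)^'+] --> (G (T i)).2 ->
  is_lift gamma `[a, next i[
    (fun s => if s <= T i then G s else (gamma s, Arg (index i) (gamma s))).
Proof.
move=> ip Tb GL Gr; apply: extend_lift_open => //.
- exact: T_ge.
- exact: next_gt.
- by apply: gamma_gap; [exact: T_ge | exact: next_le].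
- by apply: gamma_right => //; exact: T_ge.
- by move=> s; exact: gap_nonreal.
Qed.

(** Induction along the real points: the lift is prolonged over the gap after T i by the branch
    [index i], then closed at T (i + 1) by the common limit of the crossing. The right limit belongs
    to the invariant because it permits the next prolongation. *)
Let exists_lift i : (i <= p)%N -> T i < b ->
  exists G : R -> cd R n * cd R n,
  [/\ is_lift gamma `[a, T i] G, forall s, s <= T 0%N -> G s = Gamma s &
      Arg (index i) (gamma u) @[u --> (T i)^'+] --> (G (T i)).2].
Proof.
elim: i => [|i IH] ip Tb; first by exists Gamma; split=> //; exact: index0_right.
have ip' : (i <= p)%N by exact: ltnW.
have TT : T i < T i.+1 by apply: T_lt; rewrite leqnn.
have [G [GL GG Gr]] := IH ip' (lt_trans TT Tb).
have nextE : next i = T i.+1 by rewrite /next ltn_eqF.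
have aT : a < T i.+1 by exact: le_lt_trans (T_ge ip') TT.
have [||v [vl vr vL]] := @crossing_at (T i.+1) (index i).
- by rewrite in_itv /= aT.
- by have [] := T_real ip.
have := extend ip' (lt_trans TT Tb) GL Gr; rewrite nextE => /extend_lift_closed.
move=> /(_ v aT (gamma_left aT (T_le ip)) _ vL) => EL.
eexists; split.
(* Close to T (i + 1) the parameter is beyond T i, so the glued map is the branch [index i]
   there. *)
- apply: EL; move: vl; apply: cvg_trans; apply: near_eq_cvg; near=> u.
  by rewrite leNgt ifN//= negbK; near: u; exact: nbhs_left_gt.
- move=> s sT; have si := le_trans sT (T0_le ip').
  by rewrite (le_lt_trans si TT) si GG.
by rewrite /= ltxx indexS.
Unshelve. all: by end_near. Qed.

Lemma continuation_exists : exists G : R -> cd R n * cd R n,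
  is_lift gamma `[a, b[ G /\
  (forall s, s \in `[a, T 0%N] -> s < b -> G s = Gamma s).
Proof.
have [Tb|bT] := ltP (T p) b.
  have [G [GL GG Gr]] := exists_lift (leqnn p) Tb.
  have := extend (leqnn p) Tb GL Gr; rewrite /next eqxx => EL.
  eexists; split; first exact: EL.
  move=> s; rewrite in_itv /= => /andP[_ sT] _.
  by rewrite (le_trans sT (T0_le (leqnn p))) GG.
(* When the last real point is b, the interval [a, b) stops before it: the final gap starts at the
   previous real point, or the given lift already covers [a, b) if there is none. *)
have {bT} Tb : T p = b by apply/eqP; rewrite eq_le T_le.
case: (posnP p) => [p0|p_gt0].
  exists Gamma; split=> //; have [GC GL] := Gamma_lift.
  have sub : `[a, b[ `<=` `[a, T 0%N].
    by move=> s; rewrite /= !in_itv /= -p0 Tb => /andP[-> /ltW].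
  by split; [exact: continuous_subspaceW GC | move=> s /sub; exact: GL].
have qp : (p.-1 <= p)%N by exact: leq_pred.
have TT : T p.-1 < b by rewrite -Tb; apply: T_lt; lia.
have [G [GL GG Gr]] := exists_lift qp TT.
have nextE : next p.-1 = b by rewrite /next ltn_eqF ?ltn_predL// prednK.
have := extend qp TT GL Gr; rewrite nextE => EL.
eexists; split; first exact: EL.
move=> s; rewrite in_itv /= => /andP[_ sT] _.
by rewrite (le_trans sT (T0_le qp)) GG.
Qed.

Let last_index : index p = k0 + (-1) ^ k0 * signature gamma a b.
Proof.
have TS : sorted <%O (mkseq T p.+1).
  apply/(sortedP 0) => i; rewrite size_mkseq => ip.
  by rewrite !nth_mkseq ?T_lt ?leqnn//; exact: ltnW.
rewrite /index foldl_crossing_index /signature (flips_filter TS) ?foldl_flip_index//.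
  move=> s; rewrite mem_filter => /andP[/asboolP[/andP[as_ sb] sR _] _].
  by apply: re_neq0 => //; apply: gamma0; rewrite in_itv /= !ltW.
move=> s /andP[as_ sb] sR; have [|i ip ->] := real_T _ sR.
  by rewrite in_itv /= !ltW.
by apply: map_f; rewrite mem_iota.
Qed.

(** * Every continued lift follows the prescribed branches *)

Section Uniqueness.
Variable G : R -> cd R n * cd R n.
Hypothesis G_lift : is_lift gamma `[a, b[ G.
Hypothesis G_Gamma : forall s, s \in `[a, T 0%N] -> s < b -> G s = Gamma s.

Let G_left s : a < s -> s < b -> G u @[u --> s^'-] --> G s.
Proof.
move=> as_ sb; apply: (within_continuous_left G_lift.1).
  by rewrite /= in_itv /= sb ltW.
near=> u; rewrite /= in_itv /=; apply/andP; split; near: u.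
  exact: nbhs_left_ge.
by apply: filterS (nbhs_left_lt s) => u /lt_trans; exact.
Unshelve. all: by end_near. Qed.

Let G_right s : a <= s -> s < b -> G u @[u --> s^'+] --> G s.
Proof.
move=> as_ sb; apply: (within_continuous_right G_lift.1).
  by rewrite /= in_itv /= sb as_.
near=> u; rewrite /= in_itv /=; apply/andP; split; near: u.
  by apply: filterS (nbhs_right_gt s) => u /ltW; exact: le_trans.
exact: nbhs_right_lt.
Unshelve. all: by end_near. Qed.

Let G_gap i : (i <= p)%N -> T i < b ->
  Arg (index i) (gamma u) @[u --> (T i)^'+] --> (G (T i)).2 ->
  forall s, s \in `]T i, next i[ -> (G s).2 = Arg (index i) (gamma s).
Proof.
move=> ip Tb; have inab s : s \in `]T i, next i[ -> a < s /\ s < b.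
  rewrite in_itv /= => /andP[is_ sn].
  by rewrite (le_lt_trans (T_ge ip) is_) (lt_le_trans sn (next_le ip)).
apply: (@gap_unique _ _ _ (fun s => (G s).2)).
- by apply: gamma_gap; [exact: T_ge | exact: next_le].
- move=> s /inab[as_ sb].
  have Gs : G u @[u --> s] --> G s.
    by apply/left_right_continuousP; split; [exact: G_left | apply: G_right => //; exact: ltW].
  by apply: cvg_comp Gs _; exact: cvg_snd.
- by move=> s; exact: gap_nonreal.
- move=> s /inab[as_ sb]; have [|GL <-] := G_lift.2 s.
    by rewrite /= in_itv /= sb ltW.
  by rewrite -surjective_pairing.
by apply: cvg_comp (G_right (T_ge ip) Tb) _; exact: cvg_snd.
Qed.

(** The right limit at T i fixes G on the following gap; continuity from the left then fixes its
    value at T (i + 1), and the crossing identifies that value with the right limit of the next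
    branch. *)
Let G_index i : (i <= p)%N -> T i < b ->
  Arg (index i) (gamma u) @[u --> (T i)^'+] --> (G (T i)).2.
Proof.
elim: i => [|i IH] ip Tb.
  by rewrite G_Gamma//; [exact: index0_right | rewrite in_itv /= lexx T_ge].
have ip' : (i <= p)%N by exact: ltnW.
have TT : T i < T i.+1 by apply: T_lt; rewrite leqnn.
have aT : a < T i.+1 by exact: le_lt_trans (T_ge ip') TT.
have nextE : next i = T i.+1 by rewrite /next ltn_eqF.
have := G_gap ip' (lt_trans TT Tb) (IH ip' (lt_trans TT Tb)); rewrite nextE => GE.
have [||v [vl vr _]] := @crossing_at (T i.+1) (index i).
- by rewrite in_itv /= aT.
- by have [] := T_real ip.
have G2 : (G u).2 @[u --> (T i.+1)^'-] --> (G (T i.+1)).2.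
  by apply: cvg_comp (G_left aT Tb) _; exact: cvg_snd.
suff -> : (G (T i.+1)).2 = v by rewrite indexS.
apply: (norm_cvg_unique G2); move: vl; apply: cvg_trans; apply: near_eq_cvg; near=> u.
rewrite GE// in_itv /=; apply/andP.
by split; near: u; [exact: nbhs_left_gt | exact: nbhs_left_lt].
Unshelve. all: by end_near. Qed.

Lemma continuation_unique s : s \in `[T p, b[ ->
  (G s).1 = gamma s /\
  Arg_along gamma (T p)^'+ (k0 + (-1) ^ k0 * signature gamma a b) s (G s).2.
Proof.
rewrite -last_index in_itv /= => /andP[Ts sb]; have Tb := le_lt_trans Ts sb.
split.
  by have [|_ ->] := G_lift.2 s; rewrite // /= in_itv /= sb (le_trans (T_ge (leqnn p)) Ts).
(* At T p, a real point, [Arg_along] asks for the right limit; after it gamma is nonreal and the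
   branch is evaluated directly. *)
move: Ts; rewrite le_eqVlt => /predU1P[<-|Ts].
  by split=> [_|]; [exact: G_index | have [_] := T_real (leqnn p)].
have sI : s \in `]T p, next p[ by rewrite in_itv /= Ts /next eqxx.
split; first by have := gap_nonreal (leqnn p) sI.
by move=> _; exact: (G_gap (leqnn p) Tb (G_index (leqnn p) Tb) sI).
Qed.

End Uniqueness.

End Continuation.

Theorem proposition5p8 (R : realType) (A : hypercomplex) (a b : R)
    (gamma : R -> hyper R A) (p : nat) (t : 'I_p.+1 -> R)
    (k0 : int) (Gamma : R -> hyper R A * hyper R A) :
  a < b ->
  {within `[a, b], continuous gamma} ->
  (forall s, s \in `[a, b] -> gamma s != 0) ->
  tame gamma a b ->
  (forall i j : 'I_p.+1, (i < j)%N -> t i < t j) ->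
  [set s | s \in `[a, b] /\ reals (gamma s)] = range t ->
  (forall s, s \in `]a, b[ -> reals (gamma s) -> tame_parameter gamma a b s) ->
  is_lift gamma `[a, t ord0] Gamma ->
  (forall s, s \in `[a, t ord0] ->
     Arg_along gamma (if a < t ord0 then (t ord0)^'- else (t ord0)^'+)
       k0 s (Gamma s).2) ->
  let continues Gamma' :=
    is_lift gamma `[a, b[ Gamma' /\
    (forall s, s \in `[a, t ord0] -> s < b -> Gamma' s = Gamma s) in
  (exists Gamma', continues Gamma') /\
  (forall Gamma', continues Gamma' ->
     forall s, s \in `[t ord_max, b[ ->
       (Gamma' s).1 = gamma s /\
       Arg_along gamma (t ord_max)^'+
         (k0 + (-1) ^ k0 * signature gamma a b) s (Gamma' s).2).
Proof.
move=> a_lt_b gammaC gamma0 _ t_lt t_range tameP Gamma_lift Gamma_Arg /=.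
(* Indexing by natural numbers allows induction along the real points; [inord] gives a default index
   beyond p. *)
pose T i := t (inord i).
have T_lt i j : (i < j <= p)%N -> T i < T j.
  by move=> /andP[ij jp]; apply: t_lt; rewrite !inordK//; lia.
have T_real i : (i <= p)%N -> T i \in `[a, b] /\ reals (gamma (T i)).
  by move=> _; have : range t (T i); [exists (inord i) | rewrite -t_range].
have real_T s : s \in `[a, b] -> reals (gamma s) -> exists2 i, (i <= p)%N & s = T i.
  move=> sab sR; have [i _ <-] : range t s by rewrite -t_range.
  by exists i; [rewrite -ltnS | rewrite /T inord_val].
have T0 : t ord0 = T 0%N by congr t; apply: val_inj; rewrite /= inordK.
have Tp : t ord_max = T p by congr t; apply: val_inj; rewrite /= inordK.
rewrite T0 Tp in Gamma_lift Gamma_Arg *.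
have [T0ab T0R] := T_real 0%N (leq0n p).
have T0_Arg : Arg k0 (gamma u) @[u --> if a < T 0%N then (T 0%N)^'- else (T 0%N)^'+]
    --> (Gamma (T 0%N)).2.
  apply: (Gamma_Arg _ _).1 => //; rewrite in_itv /= lexx andbT.
  by move: T0ab; rewrite in_itv /= => /andP[].
split.
  exact: (continuation_exists a_lt_b gammaC gamma0 T_lt T_real real_T tameP Gamma_lift T0_Arg).
move=> G [G_lift G_Gamma] s.
exact: (continuation_unique a_lt_b gammaC gamma0 T_lt T_real real_T tameP T0_Arg
  G_lift G_Gamma).
Qed.
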